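(* Let $(X,\rho)$ be a nonempty complete metric space and let $\psi:X\to X$ satisfy, for some $\alpha\in\left[0,\frac12\right)$, $$\rho(\psi^2x,\psi^2y)\le \alpha\left(\rho(x,\psi y)+\rho(y,\psi x)\right)\quad\text{for all } x,y\in X.$$ Then there exists a point $x^*\in X$ such that for every initial point $x\in X$ the iterative sequence $(\psi^n x)_{n\in\mathbb{N}}$ converges in $(X,\rho)$ to $x^*$ (the same point for all $x$), and $\mathrm{Fix}(\psi)\subseteq\{x^*\}$.
   Context: For a self-mapping $\psi:X\to X$, $\psi^n$ denotes the $n$-fold composition of $\psi$ with itself, and $\mathrm{Fix}(\psi)=\{x\in X:\psi x=x\}$ is the set of fixed points of $\psi$. *)

(* Defs.v *)
From HB Require Import structures.
From mathcomp Require Import all_boot all_order all_algebra.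
From mathcomp Require Import all_classical all_reals all_analysis.

Set Implicit Arguments.
Unset Strict Implicit.
Unset Printing Implicit Defensive.

Local Open Scope classical_set_scope.
Local Open Scope ring_scope.

(* Completeness in the library is stated for pointed uniform spaces, so a
   completeMetricType carries a base point, hence is nonempty. *)
#[short(type="completeMetricType")]
HB.structure Definition CompleteMetric (K : numDomainType) :=
  {T of Complete T & Metric K T}.

Definition fixed_points (T : Type) (f : T -> T) : set T := [set x | f x = x].

(* Main.v *)
Require Import Defs.
From mathcomp Require Import all_boot all_order all_algebra.
From mathcomp Require Import all_classical all_reals all_analysis.
From mathcomp Require Import lra zify.
Import Order.TTheory GRing.Theory Num.Theory.

Set Implicit Arguments.
Unset Strict Implicit.
Unset Printing Implicit Defensive.

Local Open Scope classical_set_scope.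
Local Open Scope ring_scope.

(** Compare two orbits through the array [D i j] of distances between the
    [i]-th point of the one and the [j]-th point of the other.  The contraction
    hypothesis becomes the recurrence
    [D (i+2) (j+2) <= alpha * (D i (j+1) + D (i+1) j)], which bounds an entry by
    [2 * alpha < 1] times the larger of two entries with smaller indices.  If
    the array is bounded, iterating the recurrence makes it decay geometrically
    along any path where both indices go to infinity ([contr_array_geometric]).

    Boundedness is the point that needs an argument: the recurrence spreads the
    indices apart, so starting near the diagonal one reaches entries [D 0 j] and
    [D 1 j], to which it no longer applies.  The triangle inequality compares
    those with [D 2 j] at the cost of a constant, and since [D 2 j] is again
    contracted, any bound [B] with [constant + 2 * alpha * B <= B] propagates
    ([contr_array_bounded]).

    Hence the distance between far terms of any two orbits is small
    ([orbits_close]).  Applied to one orbit twice, this is the Cauchy property;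
    applied to two orbits, it shows that they have the same limit; applied to
    the constant orbit of a fixed point, it identifies that point with the
    limit. *)

(** * Arrays satisfying a contractive recurrence *)

(** The hypothesis involving [maxn] is what the triangle inequality provides: an
    index below 2 can be moved up to 2 for a bounded price, after which the
    recurrence applies. *)
Lemma contr_array_bounded (R : realFieldType) (alpha C : R)
    (D : nat -> nat -> R) :
  0 <= alpha -> alpha < 1 / 2 ->
  (forall i j, 0 <= D i j) ->
  (forall i j, D i j <= C + D (maxn i 2) (maxn j 2)) ->
  (forall i j, D i.+2 j.+2 <= alpha * (D i j.+1 + D i.+1 j)) ->
  exists B : R, forall i j, D i j <= B.
Proof.
move=> a0 a2 D0 Dup Drec.
have C0 : 0 <= C by have := Dup 2 2; rewrite maxnn; lra.
have D22 := D0 2 2.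
pose B := (C + D 2 2) / (1 - 2 * alpha).
have BE : C + D 2 2 + 2 * alpha * B = B.
  have : B * (1 - 2 * alpha) = C + D 2 2 by rewrite mulfVK //; lra.
  lra.
have B0 : 0 <= B by apply: divr_ge0; lra.
exists B.
(* Moving up to index 2 and applying the recurrence lowers the larger index by
   one, except when both are at most 1: there one only reaches [D 2 2], and
   iterating would be circular, hence the term [D 2 2] in [B]. *)
suff IH N i j : (i <= N.+1)%N -> (j <= N.+1)%N -> D i j <= B.
  by move=> i j; apply: (IH (maxn i j)); lia.
elim: N i j => [|N IHN] i j iN jN.
  have := Dup i j.
  rewrite (maxn_idPr (leq_trans iN (leqnSn 1))).
  rewrite (maxn_idPr (leq_trans jN (leqnSn 1))).
  have : 0 <= 2 * alpha * B by apply: mulr_ge0 => //; lra.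
  lra.
have [i' Ei] : exists i', maxn i 2 = i'.+2 by exists (maxn i 2 - 2)%N; lia.
have [j' Ej] : exists j', maxn j 2 = j'.+2 by exists (maxn j 2 - 2)%N; lia.
have Dij := Dup i j; rewrite Ei Ej in Dij.
have : alpha * (D i' j'.+1 + D i'.+1 j') <= alpha * (B + B).
  by rewrite ler_wpM2l // lerD // IHN //; lia.
have := Drec i' j'; lra.
Qed.

(** A step of the recurrence lowers each index by at most 2, so it can be
    repeated [k] times from any entry with both indices at least [2 * k]. *)
Lemma contr_array_geometric (R : realFieldType) (alpha B : R)
    (D : nat -> nat -> R) :
  0 <= alpha ->
  (forall i j, D i j <= B) ->
  (forall i j, D i.+2 j.+2 <= alpha * (D i j.+1 + D i.+1 j)) ->
  forall k i j, (k.*2 <= i)%N -> (k.*2 <= j)%N ->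
    D i j <= B * (2 * alpha) ^+ k.
Proof.
move=> a0 DB Drec; elim=> [|k IHk] i j; first by rewrite expr0 mulr1.
case: i j => [|[|i]] [|[|j]] //; rewrite doubleS !ltnS => ki kj.
apply: (le_trans (Drec i j)).
rewrite exprS mulrCA -mulrA [leRHS]mulrCA ler_wpM2l //.
by rewrite [leRHS]mulr_natl mulr2n; apply: lerD; apply: IHk => //; exact: leqW.
Qed.

(** * Orbits of the contraction *)

Section Orbits.
Context {R : realType} {X : metricType R} (psi : X -> X) (alpha : R).
Hypotheses (alpha_ge0 : 0 <= alpha) (alpha_lt : alpha < 1 / 2).
Hypothesis psi_contr : forall x y : X,
  mdist (iter 2 psi x) (iter 2 psi y)
    <= alpha * (mdist x (psi y) + mdist y (psi x)).

Lemma orbits_close (x y : X) (e : R) : 0 < e ->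
  exists N, forall i j, (N <= i)%N -> (N <= j)%N ->
    mdist (iter i psi x) (iter j psi y) < e.
Proof.
move=> e0.
pose D i j := mdist (iter i psi x) (iter j psi y).
have D0 i j : 0 <= D i j by exact: mdist_ge0.
have Drec i j : D i.+2 j.+2 <= alpha * (D i j.+1 + D i.+1 j).
  by rewrite /D [mdist (iter i.+1 _ _) _]metric_sym; exact: psi_contr.
(* The price of moving along the orbit of [z] from an index below 2 up to 2; it
   is paid in both orbits to reach the hypothesis of [contr_array_bounded]. *)
pose c z := mdist z (iter 2 psi z) + mdist (psi z) (iter 2 psi z).
have c_up z i : mdist (iter i psi z) (iter (maxn i 2) psi z) <= c z.
  have d0 := mdist_ge0 z (iter 2 psi z).
  have d1 := mdist_ge0 (psi z) (iter 2 psi z).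
  case: i => [|[|i]]; rewrite /c ?lerDl ?lerDr //.
  by rewrite (_ : maxn _ _ = i.+2) ?mdistxx ?addr_ge0 //; lia.
have Dup i j : D i j <= c x + c y + D (maxn i 2) (maxn j 2).
  have cx := c_up x i; have := c_up y j; rewrite metric_sym => cy.
  have := metric_triangle (iter i psi x) (iter (maxn i 2) psi x) (iter j psi y).
  have := metric_triangle (iter (maxn i 2) psi x) (iter (maxn j 2) psi y)
    (iter j psi y).
  rewrite /D; lra.
have [B DB] := contr_array_bounded alpha_ge0 alpha_lt D0 Dup Drec.
have a1 : `|2 * alpha| < 1.
  by rewrite ger0_norm; [move: alpha_lt; lra|exact: mulr_ge0].
have /cvgrPdist_lt/(_ e e0)[k _ kP] :
    geometric B (2 * alpha) n @[n --> \oo] --> 0.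
  exact: cvg_geometric.
exists k.*2 => i j ki kj.
apply: le_lt_trans (contr_array_geometric alpha_ge0 DB Drec ki kj) _.
apply: le_lt_trans (kP k (leqnn k)).
by rewrite sub0r normrN ler_norm.
Qed.

Lemma orbit_cauchy (x : X) : cauchy (iter n psi x @[n --> \oo]).
Proof.
apply/cauchy_ballP => e e0.
have [N NP] := orbits_close x x e0.
exists ([set iter n psi x | n in [set n | (N <= n)%N]],
        [set iter n psi x | n in [set n | (N <= n)%N]]) => /=.
  by split; exists N => // n /= Nn; exists n.
by move=> [_ _] /= [[i Ni <-] [j Nj <-]]; rewrite ballEmdist /=; exact: NP.
Qed.

Lemma orbits_same_limit (x y l : X) :
  iter n psi x @[n --> \oo] --> l -> iter n psi y @[n --> \oo] --> l.
Proof.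
move=> /cvg_ballP xl; apply/cvg_ballP => e e0.
have e2 : 0 < e / 2 by rewrite divr_gt0.
have [N NP] := orbits_close x y e2.
near=> n; rewrite [e]splitr; apply: (@ball_triangle _ _ (iter n psi x)).
  by near: n; exact: xl.
by rewrite ballEmdist /= NP //; near: n; exact: nbhs_infty_ge.
Unshelve. all: by end_near. Qed.

End Orbits.

Theorem corollary2p1 (R : realType) (X : completeMetricType R) (psi : X -> X)
    (alpha : R) (alpha_ge0 : 0 <= alpha) (alpha_lt : alpha < 1 / 2)
    (psi_contr : forall x y : X,
      mdist (iter 2 psi x) (iter 2 psi y)
        <= alpha * (mdist x (psi y) + mdist y (psi x))) :
  exists xstar : X,
    (forall x : X, iter n psi x @[n --> \oo] --> xstar) /\
    fixed_points psi `<=` [set xstar].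
Proof.
pose u n := iter n psi (point : X).
have /cauchy_cvgP/cvg_ex[l ul] : cauchy (u n @[n --> \oo]).
  exact: orbit_cauchy alpha_ge0 alpha_lt psi_contr point.
have all_l x : iter n psi x @[n --> \oo] --> l.
  exact: orbits_same_limit alpha_ge0 alpha_lt psi_contr _ _ _ ul.
exists l; split => // z /= zfix.
have zl := all_l z.
have /funext zE n : iter n psi z = z by elim: n => //= n ->.
rewrite zE in zl.
exact: cvg_unique (@metric_hausdorff _ X) _ _ _ _ (cvg_cst z) zl.
Qed.
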